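(* Let $g\in\mathcal{F}_0$, $f\in\mathcal{F}_1$, and let $d=d_0+d_1t$ with real numbers $d_0,d_1\ge 0$. If the Riordan array $(g,f)$ is totally positive, then the almost-Riordan array $(d_0+d_1t\,|\,g,f)$ is also totally positive.
   Context: For $k\ge 0$, $\mathcal{F}_k$ denotes the set of formal power series $\sum_{n\ge k}a_nt^n$ with real coefficients and $a_k\neq 0$. All matrices are infinite, with rows and columns indexed by $0,1,2,\dots$; writing a matrix as a list $(u_0,u_1,u_2,\dots)$ of formal power series means that the $(n,k)$ entry is the coefficient of $t^n$ in $u_k$. The Riordan array is $(g,f)=(g,gf,gf^2,\dots)$. For a formal power series $d$, the almost-Riordan array is $(d\,|\,g,f)=(d,tg,tgf,tgf^2,\dots)$ (no normalization of $d(0)$, $g(0)$, $f'(0)$ is imposed). An infinite matrix is totally positive (TP) if its minors of all orders are nonnegative. *)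

(* Defs.v *)
From mathcomp Require Import all_boot all_order all_algebra.
From mathcomp Require Import reals.

Set Implicit Arguments.
Unset Strict Implicit.
Unset Printing Implicit Defensive.

Import Order.TTheory GRing.Theory Num.Theory.
Local Open Scope ring_scope.

(* The series \sum_n (a n) t^n is represented by its coefficient sequence. *)
Definition fps (R : realType) : Type := nat -> R.

Definition fps_of_poly (R : realType) (p : {poly R}) : fps R := fun n => p`_n.

Definition fps_mul (R : realType) (a b : fps R) : fps R :=
  fun n => \sum_(i < n.+1) a i * b (n - i)%N.

Definition fps_exp (R : realType) (a : fps R) (k : nat) : fps R :=
  iter k (fps_mul a) (fps_of_poly 1).

(* The class F_k. *)
Definition fps_order (R : realType) (k : nat) (a : fps R) : Prop :=
  (forall n, (n < k)%N -> a n = 0) /\ a k <> 0.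

Definition infmx (R : realType) : Type := nat -> nat -> R.

Definition infmx_of_cols (R : realType) (u : nat -> fps R) : infmx R :=
  fun n k => u k n.

Definition riordan (R : realType) (g f : fps R) : infmx R :=
  infmx_of_cols (fun k => fps_mul g (fps_exp f k)).

Definition almost_riordan (R : realType) (d g f : fps R) : infmx R :=
  infmx_of_cols (fun k =>
    if k is k'.+1 then fps_mul (fps_of_poly 'X) (fps_mul g (fps_exp f k'))
    else d).

(* Minors are taken along strictly increasing row and column indices; the
   empty minor (m = 0) equals 1, so allowing it is harmless. *)
Definition totally_positive (R : realType) (A : infmx R) : Prop :=
  forall (m : nat) (r c : 'I_m -> nat),
    {homo r : i j / (i < j)%N} -> {homo c : i j / (i < j)%N} ->
    0 <= \det (\matrix_(i < m, j < m) A (r i) (c j)).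

(* Main.v *)
(* Below its first row and to the right of its first column, the almost-Riordan
   array is the Riordan array itself.  The rest of its first row vanishes, and so
   does its first column from row 2 on; hence a minor that uses column 0 is zero
   or is d_0 or d_1 times a minor of the Riordan array, by Laplace expansion along
   row 0 when row 0 is used, and along column 0 otherwise. *)
Require Import Defs.
From mathcomp Require Import all_boot all_order all_algebra.
From mathcomp Require Import reals.

Import Order.TTheory GRing.Theory Num.Theory.
Local Open Scope ring_scope.

Lemma fps_mulX0 (R : realType) (a : fps R) : fps_mul (fps_of_poly 'X) a 0 = 0.
Proof. by rewrite /fps_mul big_ord1 /fps_of_poly coefX mul0r. Qed.

Lemma fps_mulXS (R : realType) (a : fps R) (n : nat) :
  fps_mul (fps_of_poly 'X) a n.+1 = a n.
Proof.
rewrite /fps_mul /fps_of_poly 2!big_ord_recl !coefX mul0r add0r mul1r subn1.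
by rewrite big1 ?addr0 // => i _; rewrite coefX mul0r.
Qed.

Lemma det_row0_eq0 (R : comNzRingType) (m : nat) (M : 'M[R]_m.+1) :
  (forall j, M ord0 (lift ord0 j) = 0) ->
  \det M = M ord0 ord0 * \det (row' ord0 (col' ord0 M)).
Proof.
move=> M0; rewrite (expand_det_row M ord0) big_ord_recl big1 ?addr0.
  by rewrite /cofactor expr0 mul1r.
by move=> j _; rewrite M0 mul0r.
Qed.

(** In the Laplace expansion along the first column only the corner term survives, and its cofactor
    has sign [+1]. *)
Lemma det_col0_eq0 (R : comNzRingType) (m : nat) (M : 'M[R]_m.+1) :
  (forall i, M (lift ord0 i) ord0 = 0) ->
  \det M = M ord0 ord0 * \det (row' ord0 (col' ord0 M)).
Proof.
move=> M0; rewrite (expand_det_col M ord0) big_ord_recl big1 ?addr0.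
  by rewrite /cofactor expr0 mul1r.
by move=> i _; rewrite M0 mul0r.
Qed.

(** Lowering every index by one turns this minor of [B] into a minor of [A]; since the indices are
    positive, their predecessors still increase strictly. *)
Lemma minor_shift_ge0 (R : realType) (A B : infmx R) (m : nat)
    (r c : 'I_m -> nat) :
  totally_positive A -> (forall n k, B n.+1 k.+1 = A n k) ->
  {homo r : i j / (i < j)%N} -> {homo c : i j / (i < j)%N} ->
  (forall i, 0 < r i)%N -> (forall j, 0 < c j)%N ->
  0 <= \det (\matrix_(i < m, j < m) B (r i) (c j)).
Proof.
move=> tpA BA r_inc c_inc r_gt0 c_gt0.
have pred_inc (s : 'I_m -> nat) : {homo s : i j / (i < j)%N} ->
    (forall i, 0 < s i)%N -> {homo (fun i => (s i).-1) : i j / (i < j)%N}.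
  by move=> s_inc s_gt0 i j /s_inc; rewrite -[X in (_ < X)%N -> _]prednK ?ltnS ?prednK.
have := tpA _ _ _ (pred_inc _ r_inc r_gt0) (pred_inc _ c_inc c_gt0).
by under eq_mx => i j do rewrite -BA !prednK //.
Qed.

(** Isolates the entrywise facts about the almost-Riordan array on which the argument rests, free of
    power series. *)
Lemma totally_positive_border (R : realType) (A B : infmx R) :
  totally_positive A -> (forall n k, B n.+1 k.+1 = A n k) ->
  (forall k, B 0 k.+1 = 0) -> (forall n, B n.+2 0 = 0) ->
  0 <= B 0 0 -> 0 <= B 1 0 -> totally_positive B.
Proof.
move=> tpA BA B0S BSS0 B00 B10 [|m] r c r_inc c_inc.
  by rewrite det_mx00.
have pos_lift (s : 'I_m.+1 -> nat) i :
    {homo s : i j / (i < j)%N} -> (s ord0 < s (lift ord0 i))%N by apply.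
have lift_inc (s : 'I_m.+1 -> nat) : {homo s : i j / (i < j)%N} ->
    {homo (fun i => s (lift ord0 i)) : i j / (i < j)%N}.
  by move=> s_inc i j ij; apply: s_inc; rewrite !lift0.
set M := (\matrix_(i, j) _).
have B0 k : (0 < k)%N -> B 0 k = 0 by case: k.
have BS0 n : (1 < n)%N -> B n 0 = 0 by case: n => [|[]].
(* Every index after the first exceeds it, hence is positive, so this submatrix lies in the shifted
   copy of [A]. *)
have subM_ge0 : 0 <= \det (row' ord0 (col' ord0 M)).
  have -> : row' ord0 (col' ord0 M) =
      \matrix_(i, j) B (r (lift ord0 i)) (c (lift ord0 j)).
    by apply/matrixP => i j; rewrite !mxE.
  apply: (minor_shift_ge0 _ _ _ _ _ _ tpA BA (lift_inc _ r_inc) (lift_inc _ c_inc)) => i.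
    exact: leq_ltn_trans (pos_lift r i r_inc).
  exact: leq_ltn_trans (pos_lift c i c_inc).
have [r0|r0_gt0] := posnP (r ord0).
  rewrite det_row0_eq0 => [|j]; last first.
    by rewrite mxE r0 B0 // (leq_ltn_trans _ (pos_lift c j c_inc)).
  apply: mulr_ge0 subM_ge0; rewrite mxE r0.
  by case: (c ord0) => [//|k]; rewrite B0S.
(* Now [r ord0] is at least 1, so the later rows have index at least 2 and vanish in column 0. The
   corner is [B 1 0] or 0. *)
have [c0|c0_gt0] := posnP (c ord0).
  rewrite det_col0_eq0 => [|i]; last first.
    by rewrite mxE c0 BS0 // (leq_ltn_trans r0_gt0 (pos_lift r i r_inc)).
  apply: mulr_ge0 subM_ge0; rewrite mxE c0.
  by case: (r ord0) r0_gt0 => [//|[//|n]] _; rewrite BSS0.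
(* Neither row 0 nor column 0 is used: the whole minor lies in the shifted copy of [A]. *)
have inc_gt0 (s : 'I_m.+1 -> nat) i :
    {homo s : i j / (i < j)%N} -> (0 < s ord0)%N -> (0 < s i)%N.
  move=> s_inc s0; case: (unliftP ord0 i) => [j ->|-> //].
  exact: leq_ltn_trans (pos_lift s j s_inc).
by apply: (minor_shift_ge0 _ _ _ _ _ _ tpA BA r_inc c_inc) => i; apply: inc_gt0.
Qed.

Theorem theorem2p5 (R : realType) (g f : fps R) (d0 d1 : R)
    (hg : fps_order 0 g) (hf : fps_order 1 f)
    (hd0 : 0 <= d0) (hd1 : 0 <= d1)
    (hTP : totally_positive (riordan g f)) :
  totally_positive (almost_riordan (fps_of_poly (d0%:P + d1 *: 'X)) g f).
Proof.
(* The factor ['X] shifts the later columns down by one; column 0 stops after row 1 because its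
   polynomial has degree at most 1. *)
apply: (totally_positive_border _ _ _ hTP) => [n k|k|n||];
  rewrite /almost_riordan /infmx_of_cols /=.
- exact: fps_mulXS.
- exact: fps_mulX0.
- by rewrite /fps_of_poly coefD coefC coefZ coefX mulr0 addr0.
- by rewrite /fps_of_poly coefD coefC coefZ coefX mulr0 addr0.
- by rewrite /fps_of_poly coefD coefC coefZ coefX mulr1 add0r.
Qed.
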